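(* Let $W$ be a finite Coxeter group with simple reflections $s_1,\ldots,s_n$ and length function $\ell$, and let $H$ be the Iwahori-Hecke algebra of $W$ with parameter $q$ and basis $\{T_w\}_{w\in W}$. Let $0<\theta\le1$, $q=\theta^{-1}$, $\tilde T_i=T_{s_i}/q$ and $\tilde T_w=q^{-\ell(w)}T_w$ for $w\in W$. For each $i$, the Metropolis chain $K_i$ on $W$ is the same as the matrix of left multiplication by $\tilde T_i$ with respect to the basis $\{\tilde T_w\}_{w\in W}$ of $H$, that is $\tilde T_i\tilde T_w=\sum_{w'\in W}K_i(w,w')\tilde T_{w'}$ for all $w\in W$; explicitly, $$\tilde T_i\tilde T_w=\begin{cases}\tilde T_{s_iw},&\text{if }\ell(s_iw)>\ell(w),\\ (1-\theta)\tilde T_w+\theta\,\tilde T_{s_iw},&\text{if }\ell(s_iw)<\ell(w).\end{cases}$$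
   Context: The Iwahori-Hecke algebra $H$ of $W$ with parameter $q$ is the complex algebra with basis $\{T_w\mid w\in W\}$ and multiplication determined by $T_{s_i}T_w=T_{s_iw}$ if $\ell(s_iw)=\ell(w)+1$ and $T_{s_i}T_w=(q-1)T_w+qT_{s_iw}$ if $\ell(s_iw)=\ell(w)-1$. The Metropolis chain $K_i$ on $W$ is the Markov chain with transition matrix: $K_i(x,y)=1$ if $y=s_ix$ and $\ell(y)>\ell(x)$; $K_i(x,y)=\theta$ if $y=s_ix$ and $\ell(y)<\ell(x)$; $K_i(x,y)=1-\theta$ if $y=x$ and $\ell(s_ix)<\ell(x)$; and $K_i(x,y)=0$ otherwise. *)

(* Defs.v *)
From HB Require Import structures.
From mathcomp Require Import all_boot all_order all_algebra.
From mathcomp Require Import all_fingroup all_field.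
From mathcomp Require Import reals complex.

Set Implicit Arguments.
Unset Strict Implicit.
Unset Printing Implicit Defensive.

Import Order.TTheory GRing.Theory Num.Theory.

Local Open Scope ring_scope.
Local Open Scope complex_scope.

(* [s] and [m] present [W]: the [s i] generate [W] and satisfy the relations
   (s_i s_j)^{m_ij} = 1, and [W] is universal among all groups, finite or not,
   with such elements. *)
Definition coxeter_presentation (W : finGroupType) (n : nat)
    (m : 'I_n -> 'I_n -> nat) (s : 'I_n -> W) : Prop :=
  [/\ <<[set s i | i : 'I_n]>>%g = [set: W],
      forall i j, ((s i * s j) ^+ m i j = 1)%g
    & forall (G : groupType) (t : 'I_n -> G),
        (forall i j, ((t i * t j) ^+ m i j = 1)%g) ->
        exists2 f : W -> G,
          {morph f : x y / (x * y)%g} & forall i, f (s i) = t i].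

(* All off-diagonal entries of the Coxeter matrix are finite because the group
   is. *)
Record finCoxeterSystem := FinCoxeterSystem {
  coxeter_group :> finGroupType;
  coxeter_rank : nat;
  coxeter_matrix : 'I_coxeter_rank -> 'I_coxeter_rank -> nat;
  simple : 'I_coxeter_rank -> coxeter_group;
  coxeter_matrix_diag : forall i, coxeter_matrix i i = 1%N;
  coxeter_matrix_offdiag :
    forall i j, i != j -> (2 <= coxeter_matrix i j)%N;
  coxeter_matrix_sym :
    forall i j, coxeter_matrix i j = coxeter_matrix j i;
  coxeter_presented : coxeter_presentation coxeter_matrix simple
}.

Arguments simple {f} _.

Section Length.

Variable W : finCoxeterSystem.

Definition has_word (w : W) (k : nat) : bool :=
  [exists u : k.-tuple 'I_(coxeter_rank W), w == (\prod_(i <- u) simple i)%g].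

Lemma has_word_ex (w : W) : exists k, has_word w k.
Proof.
have [gen _ _] := coxeter_presented W.
have /gen_prodgP[k [c cS ->]] : w \in <<[set simple i | i : 'I_(coxeter_rank W)]>>%g.
  by rewrite gen inE.
have c_simple i : exists j, c i == simple j.
  by have /imsetP[j _ ->] := cS i; exists j.
exists k; apply/existsP; exists [tuple xchoose (c_simple i) | i < k].
apply/eqP; rewrite big_tuple; apply: eq_bigr => i _.
by rewrite tnth_mktuple; exact/eqP/(xchooseP (c_simple i)).
Qed.

Definition length (w : W) : nat := ex_minn (has_word_ex w).

End Length.

Section Hecke.

Variables (R : realType) (W : finCoxeterSystem) (H : falgType R[i]).

(* A family indexed by [W], listed in the order of [enum W]. *)
Definition family_tuple (b : W -> H) : #|{: W}|.-tuple H :=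
  [tuple b (enum_val k) | k < #|{: W}|].

(* [H], with the family [T], is the Iwahori-Hecke algebra with parameter [q].
   The two rules determine the multiplication of [H], and force T_1 = 1. *)
Definition is_hecke_algebra (q : R[i]) (T : W -> H) : Prop :=
  [/\ basis_of {:H} (family_tuple T),
      forall i w, length (simple i * w)%g = (length w).+1 ->
        T (simple i) * T w = T (simple i * w)%g
    & forall i w, (length (simple i * w)%g).+1 = length w ->
        T (simple i) * T w = (q - 1) *: T w + q *: T (simple i * w)%g].

Definition tilde_gen (q : R[i]) (T : W -> H) (i : 'I_(coxeter_rank W)) : H :=
  q^-1 *: T (simple i).

Definition tilde (q : R[i]) (T : W -> H) (w : W) : H :=
  q ^- length w *: T w.

(* Entry (w, w') is the coefficient of b_w' in h * b_w, so that row w contains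
   the coordinates of the image of b_w. *)
Definition lmul_coef (b : W -> H) (h : H) (w w' : W) : R[i] :=
  coord (family_tuple b) (enum_rank w') (h * b w).

End Hecke.

Definition metropolis (R : realType) (W : finCoxeterSystem) (theta : R)
    (i : 'I_(coxeter_rank W)) (x y : W) : R :=
  if (y == (simple i * x)%g) && (length x < length y)%N then 1
  else if (y == (simple i * x)%g) && (length y < length x)%N then theta
  else if (y == x) && (length (simple i * x)%g < length x)%N then 1 - theta
  else 0.

(* Main.v *)
Require Import Defs.
From HB Require Import structures.
From mathcomp Require Import all_boot all_order all_algebra.
From mathcomp Require Import all_fingroup all_field.
From mathcomp Require Import reals complex.

Set Implicit Arguments.
Unset Strict Implicit.
Unset Printing Implicit Defensive.

Import Order.TTheory GRing.Theory Num.Theory.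

Local Open Scope ring_scope.
Local Open Scope complex_scope.

(** The Hecke relations speak of the cases l(s w) = l(w) + 1 and
    l(s w) = l(w) - 1, whereas the Metropolis chain only compares l(s w) with
    l(w), so the one fact about Coxeter groups that matters is that these two
    cases are exhaustive ([length_simple]).  As s^2 = 1, the two lengths differ
    by at most one; they cannot agree because the relations
    (s_i s_j)^m_ij = 1 are respected by the assignment of the
    nontrivial involution of a two-element group to every s_i.  The universal
    property then provides a sign character, which shows that all words for
    w have the same parity.

    The rest is the rescaling T_w |-> q^-l(w) T_w.  It is invertible, hence
    preserves bases.  Going up, the factors q^-1 and q^-l(w) multiply to
    q^-l(sw).  Going down, q^-1 (q - 1) = 1 - theta, while the coefficient of
    T_(sw) is q^-l(w) = q^-1 q^-l(sw), so that of its rescaling is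
    q^-1 = theta.  These are the rows of the Metropolis matrix. *)

(** * Length and parity in a Coxeter group *)

Section CoxeterLength.

Variable W : finCoxeterSystem.
Implicit Types (w : W) (u : seq 'I_(coxeter_rank W)).

Lemma length_leq_word u : (length (\prod_(i <- u) simple i : W)%g <= size u)%N.
Proof.
rewrite /length; case: ex_minnP => k _; apply.
by apply/existsP; exists (in_tuple u).
Qed.

Lemma reduced_word w :
  exists2 u, w = (\prod_(i <- u) simple i)%g & length w = size u.
Proof.
rewrite /length; case: ex_minnP => k /existsP[u /eqP wE] _.
by exists u; rewrite ?size_tuple.
Qed.

(** This is the relation (s_i s_i)^m_ii = 1, since m_ii = 1. *)
Lemma simple_sqr i : (simple i * simple i = 1 :> W)%g.
Proof.
have [_ rel _] := coxeter_presented W.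
by have := rel i i; rewrite coxeter_matrix_diag.
Qed.

Lemma simpleK i : involutive (fun w : W => simple i * w)%g.
Proof. by move=> w; rewrite mulgA simple_sqr mul1g. Qed.

(** The sign character is obtained from the universal property, with the
    permutations of two points as target, so that the parity of a permutation
    reads off the parity of a word. *)
Lemma word_parity :
  exists sgn : W -> bool,
    forall u, sgn (\prod_(i <- u) simple i)%g = odd (size u).
Proof.
have [_ _ univ] := coxeter_presented W.
pose t := tperm true false.
have [|f fM fs] := univ {perm bool} (fun=> t).
  by move=> i j; rewrite tperm2 expg1n.
have f1 : f 1%g = 1%g by apply: (mulgI (f 1%g)); rewrite -fM !mulg1.
exists (fun w => odd_perm (f w)); elim=> [|i u IHu].
  by rewrite big_nil f1 odd_perm1.
by rewrite big_cons fM fs odd_permM odd_tperm IHu.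
Qed.

Lemma length_simple_leq i w : (length (simple i * w)%g <= (length w).+1)%N.
Proof.
have [u -> ->] := reduced_word w.
by have := length_leq_word (i :: u); rewrite big_cons.
Qed.

Lemma odd_length_simple i w : odd (length (simple i * w)%g) = ~~ odd (length w).
Proof.
have [sgn sgnE] := word_parity.
have [u wE ->] := reduced_word w; have [v swE ->] := reduced_word (simple i * w)%g.
by rewrite -sgnE -swE wE; have := sgnE (i :: u); rewrite big_cons.
Qed.

(** By [simpleK] the bound [length_simple_leq] applies in both directions, and
    parity excludes equality. *)
Lemma length_simple i w :
  length (simple i * w)%g = (length w).+1 \/
  (length (simple i * w)%g).+1 = length w.
Proof.
have up := length_simple_leq i w.
have := length_simple_leq i (simple i * w)%g; rewrite simpleK => down.
have := odd_length_simple i w.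
case: (ltngtP (length (simple i * w)%g) (length w)) => [lt|gt|->].
- by right; apply/eqP; rewrite eqn_leq lt.
- by left; apply/eqP; rewrite eqn_leq up.
- by case: odd.
Qed.

Lemma length_simple_up i w : (length w < length (simple i * w)%g)%N ->
  length (simple i * w)%g = (length w).+1.
Proof. by case: (length_simple i w) => // <-; rewrite ltnNge leqnSn. Qed.

Lemma length_simple_down i w : (length (simple i * w)%g < length w)%N ->
  (length (simple i * w)%g).+1 = length w.
Proof. by case: (length_simple i w) => // ->; rewrite ltnNge leqnSn. Qed.

End CoxeterLength.

(** * Families of vectors indexed by the group *)

Section Families.

Variables (R : realType) (W : finCoxeterSystem) (H : falgType R[i]).
Implicit Types (b : W -> H) (c : W -> R[i]).

Lemma family_tupleE b w : (family_tuple b)`_(enum_rank w) = b w.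
Proof. by rewrite -tnth_nth tnth_mktuple enum_rankK. Qed.

(** The number of vectors is unchanged, so it suffices that the rescaled family
    spans, which holds because the scalars can be undone. *)
Lemma basis_family_scale b c : (forall w, c w != 0) ->
  basis_of {:H} (family_tuple b) ->
  basis_of {:H} (family_tuple (fun w => c w *: b w)).
Proof.
move=> c_neq0 b_basis; rewrite basisEdim (size_basis b_basis) size_tuple leqnn.
rewrite andbT -(span_basis b_basis); apply/span_subvP => _ /tnthP[k ->].
rewrite tnth_mktuple -(scalerK (c_neq0 (enum_val k)) (b _)) memvZ //.
by apply/memv_span/tnthP; exists k; rewrite tnth_mktuple.
Qed.

Lemma coord_family_sum b c w : basis_of {:H} (family_tuple b) ->
  coord (family_tuple b) (enum_rank w) (\sum_w' c w' *: b w') = c w.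
Proof.
move=> /basis_free b_free.
rewrite (reindex (@enum_val W predT)) /=; last exact/onW_bij/enum_val_bij.
under eq_bigr => k _ do rewrite -family_tupleE enum_valK.
by rewrite coord_sum_free // enum_rankK.
Qed.

Lemma sum_family_delta b w : \sum_w' (w' == w)%:R *: b w' = b w.
Proof.
rewrite (bigD1 w) //= eqxx scale1r big1 ?addr0 // => w' /negPf->.
by rewrite scale0r.
Qed.

End Families.

(** * Rows of the Metropolis matrix *)

Section Metropolis.

Variables (R : realType) (W : finCoxeterSystem) (theta : R).
Implicit Types (i : 'I_(coxeter_rank W)) (w : W).

Lemma metropolis_up i w w' : (length w < length (simple i * w)%g)%N ->
  metropolis theta i w w' = (w' == simple i * w)%g%:R.
Proof.
move=> up; rewrite /metropolis [(length (_ * w)%g < _)%N]ltnNge (ltnW up) andbF.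
by case: eqP => //= ->; rewrite up.
Qed.

Lemma metropolis_down i w w' : (length (simple i * w)%g < length w)%N ->
  metropolis theta i w w' =
  (1 - theta) * (w' == w)%:R + theta * (w' == simple i * w)%g%:R.
Proof.
move=> down; rewrite /metropolis down andbT; case: eqP => [->|_] /=.
  have /negPf-> : (simple i * w != w)%g.
    by apply/eqP => swE; rewrite swE ltnn in down.
  by rewrite ltnNge (ltnW down) down mulr0 mulr1 add0r.
by rewrite mulr0 addr0; case: eqP; rewrite ?mulr1 ?mulr0.
Qed.

End Metropolis.

(** * Multiplication in the rescaled basis *)

Section TildeMultiplication.

Variables (R : realType) (W : finCoxeterSystem) (H : falgType R[i]).
Variables (q : R[i]) (T : W -> H).
Hypotheses (q_neq0 : q != 0) (hecke : is_hecke_algebra q T).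

Lemma basis_tilde : basis_of {:H} (family_tuple (tilde q T)).
Proof.
have [T_basis _ _] := hecke.
by apply: basis_family_scale => // w; rewrite invr_eq0 expf_neq0.
Qed.

Lemma tilde_gen_mul_up i w : (length w < length (simple i * w)%g)%N ->
  tilde_gen q T i * tilde q T w = tilde q T (simple i * w)%g.
Proof.
have [_ mul_up _] := hecke => /length_simple_up sw_len.
rewrite /tilde_gen /tilde -scalerAl -scalerAr mul_up // scalerA sw_len.
by rewrite exprS invfM.
Qed.

Lemma tilde_gen_mul_down i w : (length (simple i * w)%g < length w)%N ->
  tilde_gen q T i * tilde q T w =
  (1 - q^-1) *: tilde q T w + q^-1 *: tilde q T (simple i * w)%g.
Proof.
have [_ _ mul_down] := hecke => /length_simple_down sw_len.
rewrite /tilde_gen /tilde -scalerAl -scalerAr mul_down // !scalerDr !scalerA.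
congr (_ *: _ + _ *: _).
  by rewrite mulrAC mulrBr mulVf // mulr1.
by rewrite -sw_len exprS invfM mulrAC mulVf // mul1r.
Qed.

End TildeMultiplication.

Theorem theorem4p3 (R : realType) (W : finCoxeterSystem)
    (H : falgType R[i]) (T : W -> H) (theta : R) (q : R[i])
    (theta_gt0 : 0 < theta) (theta_le1 : theta <= 1)
    (q_def : q = (theta^-1)%:C)
    (hecke : is_hecke_algebra q T) :
  basis_of {:H} (family_tuple (tilde q T)) /\
  forall i : 'I_(coxeter_rank W),
  [/\ forall w w' : W,
        (metropolis theta i w w')%:C =
        lmul_coef (tilde q T) (tilde_gen q T i) w w',
      forall w : W,
        tilde_gen q T i * tilde q T w =
        \sum_(w' : W) (metropolis theta i w w')%:C *: tilde q T w',
      forall w : W, (length w < length (simple i * w)%g)%N ->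
        tilde_gen q T i * tilde q T w = tilde q T (simple i * w)%g
    & forall w : W, (length (simple i * w)%g < length w)%N ->
        tilde_gen q T i * tilde q T w =
        (1 - theta%:C) *: tilde q T w
        + theta%:C *: tilde q T (simple i * w)%g].
Proof.
have qV : q^-1 = theta%:C by rewrite q_def fmorphV invrK.
have q_neq0 : q != 0 by rewrite -invr_eq0 qV fmorph_eq0 gt_eqF.
have tilde_basis := basis_tilde q_neq0 hecke.
split=> // i.
have down w : (length (simple i * w)%g < length w)%N ->
    tilde_gen q T i * tilde q T w =
    (1 - theta%:C) *: tilde q T w + theta%:C *: tilde q T (simple i * w)%g.
  by rewrite -qV; exact: tilde_gen_mul_down.
have row w : tilde_gen q T i * tilde q T w =
    \sum_(w' : W) (metropolis theta i w w')%:C *: tilde q T w'.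
  have [sw_len|sw_len] := length_simple i w.
    have lt_sw : (length w < length (simple i * w)%g)%N by rewrite sw_len.
    rewrite tilde_gen_mul_up // -[LHS]sum_family_delta.
    by apply: eq_bigr => w' _; rewrite metropolis_up // rmorph_nat.
  have lt_sw : (length (simple i * w)%g < length w)%N by rewrite -sw_len.
  rewrite down // -[in LHS](sum_family_delta _ w).
  rewrite -[in LHS](sum_family_delta _ (simple i * w)%g).
  rewrite !scaler_sumr -big_split; apply: eq_bigr => w' _ /=.
  rewrite metropolis_down // !(scalerA _ _ (tilde q T w')) -scalerDl.
  congr (_ *: _).
  by rewrite rmorphD !rmorphM rmorphB rmorph1 !rmorph_nat.
split=> // [w w'|w]; last exact: tilde_gen_mul_up.
by rewrite /lmul_coef row (coord_family_sum (fun w' => (metropolis theta i w w')%:C)).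
Qed.
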